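(* Let $\overline{p}=(p_i)_{i\geq 1}$ be a sequence in $]0,1]$ and let $S$ be the transition operator of the stochastic Fibonacci adding machine associated to $\overline{p}$, acting on $l^\infty(\mathbb{N})$. Let $E:=\{\lambda\in\mathbb{C}:(q_{F_n}(\lambda))_{n\geq 0}\text{ is bounded}\}$. Then $E$ is contained in the approximate point spectrum $\sigma_a(S)$. In particular, $E\subset\sigma(S)$.
   Context: $\mathbb{N}=\{0,1,2,\ldots\}$. Fibonacci numbers: $F_0=1$, $F_1=2$, $F_n=F_{n-1}+F_{n-2}$ for $n\geq 2$. Every $N\in\mathbb{N}$ has a unique Fibonacci expansion $N=\sum_{i\geq 0}\varepsilon_i(N)F_i$ with $\varepsilon_i(N)\in\{0,1\}$, finitely many nonzero digits, and no two consecutive digits both equal to $1$. $[x]$ denotes the integer part of $x$. Stochastic Fibonacci adding machine: let $\overline{p}=(p_i)_{i\geq 1}\subset\,]0,1]$. It is the Markov chain on $\mathbb{N}$ whose one-step transition from a state $N$ with digits $\varepsilon_i=\varepsilon_i(N)$ is as follows. Draw independent random variables $(e_i)_{i\geq 0}$ with $e_i=1$ with probability $p_{i+1}$ and $e_i=0$ with probability $1-p_{i+1}$ (drawn afresh at each step). Put $c_{-1}=1$. The new state is $N'=\sum_i\varepsilon'_iF_i$, where: (a) if $\varepsilon_0=0$, then for all $i\geq 0$: $\varepsilon'_{2i}=\left[\frac{\varepsilon_{2i}+e_ic_{i-1}}{e_i\varepsilon_{2i+1}c_{i-1}+1}\right]$, $\varepsilon'_{2i+1}=\left[\frac{\varepsilon_{2i+1}}{e_ic_{i-1}+1}\right]$,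 $c_i=e_ic_{i-1}\varepsilon_{2i+1}$; (b) if $\varepsilon_0=1$, then $\varepsilon'_0=\left[\frac{1}{e_0+1}\right]$, $c_0=e_0$, and for all $i\geq 1$: $\varepsilon'_{2i-1}=\left[\frac{\varepsilon_{2i-1}+e_ic_{i-1}}{e_i\varepsilon_{2i}c_{i-1}+1}\right]$, $\varepsilon'_{2i}=\left[\frac{\varepsilon_{2i}}{e_ic_{i-1}+1}\right]$, $c_i=e_ic_{i-1}\varepsilon_{2i}$. $S=(S_{i,j})_{i,j\geq 0}$ is the transition matrix ($S_{i,j}$ is the one-step probability of moving from $i$ to $j$), acting on bounded complex sequences by $(Sv)_i=\sum_{j\geq 0}S_{i,j}v_j$. The spectrum $\sigma(S)$ is the set of $\lambda\in\mathbb{C}$ such that $S-\lambda I$ is not bijective on $l^\infty(\mathbb{N})$. The approximate point spectrum $\sigma_a(S)$ is the set of $\lambda\in\mathbb{C}$ for which there is a sequence $(x_n)_{n\geq 0}$ in $l^\infty(\mathbb{N})$ with $\|x_n\|_\infty=1$ for all $n$ and $\lim_{n\to\infty}\|(\lambda I-S)x_n\|_\infty=0$. The functions $q_{F_n}$: with $r_n=p_{\left[\frac{n+1}{2}\right]+1}$ for $n\geq 1$, $q_{F_0}(\lambda)=\frac{\lambda-(1-p_1)}{p_1}$, $q_{F_1}(\lambda)=\frac{1}{p_2}q_{F_0}(\lambda)^2-\left(\frac{1}{p_2}-1\right)$, and $q_{F_n}(\lambda)=\frac{1}{r_n}q_{F_{n-1}}(\lambda)q_{F_{n-2}}(\lambda)-\left(\frac{1}{r_n}-1\right)$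 for $n\geq 2$. *)

(* Defs.v *)
From HB Require Import structures.
From mathcomp Require Import all_boot all_order all_algebra.
From mathcomp Require Import all_classical all_reals all_analysis.
From mathcomp Require Import complex zify.

Set Implicit Arguments.
Unset Strict Implicit.
Unset Printing Implicit Defensive.

Import Order.TTheory GRing.Theory Num.Theory numFieldNormedType.Exports.

Local Open Scope classical_set_scope.
Local Open Scope ring_scope.
Local Open Scope complex_scope.

Fixpoint fib (n : nat) : nat :=
  match n with
  | 0 => 1
  | n1.+1 => match n1 with
             | 0 => 2
             | n2.+1 => fib n1 + fib n2
             end
  end%N.

(* [\sum_(i \in [set: nat])] is the sum of a finitely supported family. *)
Definition fib_value (eps : nat -> nat) : nat :=
  \sum_(i \in [set: nat]) (eps i * fib i)%N.

Definition fib_expansion (N : nat) (eps : nat -> nat) : Prop :=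
  [/\ forall i, (eps i <= 1)%N,
      finite_set [set i | eps i != 0%N],
      forall i, ~ (eps i = 1%N /\ eps i.+1 = 1%N)
    & N = fib_value eps].

Definition admissible (eps : nat -> nat) : Prop :=
  (forall i, (eps i <= 1)%N) /\ (forall i, ~ (eps i = 1%N /\ eps i.+1 = 1%N)).

Lemma fib_valueE (eps : nat -> nat) (n : nat) :
  (forall i, (n <= i)%N -> eps i = 0%N) ->
  fib_value eps = (\sum_(i < n) eps i * fib i)%N.
Proof.
move=> eps0; rewrite /fib_value.
rewrite -(@fsbig_widen _ _ _ _ `I_n) //= => [|i [_ /negP]]; last first.
  by rewrite -leqNgt /= => /eps0 ->; rewrite mul0n.
by rewrite -fsbig_ord; apply: eq_bigr.
Qed.

Lemma fibSS n : fib n.+2 = (fib n.+1 + fib n)%N.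
Proof. by []. Qed.

Lemma fib_gt0 n : (0 < fib n)%N.
Proof. by elim: n => [|[|n] IH] //; rewrite fibSS addn_gt0 IH. Qed.

Lemma fib_gt n : (n < fib n)%N.
Proof.
elim: n => [|[|n] IH] //.
by have := fib_gt0 n; rewrite fibSS; move: IH; lia.
Qed.

Lemma fib_expansion_exists_lt n N : (N < fib n)%N ->
  exists eps, [/\ admissible eps, forall i, (n <= i)%N -> eps i = 0%N
                & N = (\sum_(i < n) eps i * fib i)%N].
Proof.
have [m] := ubnP n; elim: m n N => // m IH [|n] N ltm ltN.
  by exists (fun=> 0%N); split=> //; [split=> // i []|rewrite big_ord0; case: N ltN].
have [ltNn|leNn] := ltnP N (fib n).
  have [eps [adm eps0 ->]] := IH n N ltm ltNn; exists eps; split=> // [i /ltnW/eps0//|].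
  by rewrite big_ord_recr /= eps0 // mul0n addn0.
case: n ltm ltN leNn => [|n] ltm ltN leNn.
  exists (fun i => (i == 0)%N : nat); split=> [|[]//|].
    by split=> [[]|[|i] []].
  by rewrite big_ord_recr big_ord0 /=; move: ltN leNn => /=; lia.
have [|eps [[le1 nc] eps0 defN]] := IH n (N - fib n.+1)%N (ltnW ltm).
  by move: ltN leNn; rewrite fibSS; lia.
exists (fun i => if i == n.+1 then 1%N else eps i); split.
- split=> i; first by case: eqP.
  case: eqP => [->|_]; first by rewrite gtn_eqF // eps0; [case|lia].
  by case: eqP => [[->]|_] []; [rewrite eps0|move=> a b; exact: (nc i)].
- by move=> i lti; rewrite gtn_eqF // eps0 //; lia.
rewrite !big_ord_recr /= eqxx ltn_eqF // eps0 // mul0n addn0 mul1n.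
rewrite (eq_bigr (fun i : 'I_n => eps i * fib i)%N) -?defN => [|i _].
  by rewrite subnK.
by rewrite ltn_eqF // ltnW // ltnS.
Qed.

Lemma fib_expansion_exists N : exists eps, fib_expansion N eps.
Proof.
have [eps [[le1 nc] eps0 defN]] := fib_expansion_exists_lt (fib_gt N).
exists eps; split=> //; last by rewrite (fib_valueE eps0).
apply: (sub_finite_set _ (finite_II N)) => i /= /eqP epsi.
by rewrite ltnNge; apply/negP => /eps0.
Qed.

(* The default value is never used: see [fib_digitsP]. *)
Definition fib_digits (N : nat) : nat -> nat :=
  xget (fun=> 0%N) [set eps | fib_expansion N eps].

Lemma fib_digitsP N : fib_expansion N (fib_digits N).
Proof.
by rewrite /fib_digits; case: xgetP => // nex; have [eps /nex] := fib_expansion_exists N.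
Qed.

Lemma sum_recr (eps : nat -> nat) n : (\sum_(i < n.+1) eps i * fib i =
  \sum_(i < n) eps i * fib i + eps n * fib n)%N.
Proof. exact: big_ord_recr. Qed.

Lemma admissible_lt eps n :
  admissible eps -> (\sum_(i < n) eps i * fib i < fib n)%N.
Proof.
case=> le1 nc; have [m] := ubnP n; elim: m n => // m IH [|[|n]] ltm.
- by rewrite big_ord0.
- by rewrite big_ord_recr big_ord0 /= add0n muln1; have := le1 0%N; lia.
have := IH n.+1 ltm; have := IH n (ltnW ltm).
have := le1 n; have := le1 n.+1; have := fib_gt0 n; have := nc n.
rewrite fibSS !sum_recr.
case: (eps n.+1) (eps n) => [|[|k]] [|[|k']] // nc1; lia.
Qed.

Lemma admissible_inj eps eps' n : admissible eps -> admissible eps' ->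
  (\sum_(i < n) eps i * fib i = \sum_(i < n) eps' i * fib i)%N ->
  forall i, (i < n)%N -> eps i = eps' i.
Proof.
move=> adm adm'; elim: n => // n IH; rewrite !sum_recr => eqS i.
have lt1 := admissible_lt n adm; have lt2 := admissible_lt n adm'.
have := adm.1 n; have := adm'.1 n => le2 le1.
have eqn : eps n = eps' n.
  case: (eps n) (eps' n) le1 le2 eqS => [|[|//]] [|[|//]] _ _ ?; lia.
rewrite ltnS leq_eqVlt => /orP[/eqP->//|]; apply: IH.
by move: eqS; rewrite eqn => /addIn.
Qed.

Lemma fib_expansion_uniq N eps eps' :
  fib_expansion N eps -> fib_expansion N eps' -> eps = eps'.
Proof.
have bnd u : finite_set [set i | u i != 0%N] ->
    exists n, forall i, (n <= i)%N -> u i = 0%N.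
  move=> /finite_seqP[s us]; exists (\max_(j <- s) j).+1 => i lti.
  apply/eqP; apply: contraTT lti => ui; rewrite -leqNgt.
  have : [set` s] i by rewrite -us.
  by move=> /= si; rewrite (big_rem i) //= leq_maxl.
case=> le1 fin nc defN [le1' fin' nc' defN'].
have [n eps0] := bnd _ fin; have [n' eps0'] := bnd _ fin'.
apply/funext => i; pose m := (maxn n n' + i.+1)%N.
have hm k : (m <= k)%N -> (n <= k)%N /\ (n' <= k)%N by rewrite /m; lia.
apply: (@admissible_inj _ _ m) => //; last by rewrite /m; lia.
rewrite -!fib_valueE -?defN -?defN' // => k /hm[h h']; [exact: eps0'|exact: eps0].
Qed.

Section Step.
Variables (e : nat -> bool) (eps : nat -> nat).

(* Carries are shifted by one: [carry_a i] and [carry_b i] stand for c_{i-1}. *)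
Fixpoint carry_a (i : nat) : nat :=
  if i is j.+1 then (e j * carry_a j * eps j.*2.+1)%N else 1%N.

Fixpoint carry_b (i : nat) : nat :=
  match i with
  | 0 => 1%N
  | j.+1 => if j is 0 then e 0 : nat else (e j * carry_b j * eps j.*2)%N
  end.

(* The position k is 2i or 2i+1 with i = k./2 in case (a); for k > 0 it is
   2i-1 or 2i with i = uphalf k in case (b). *)
Definition digit_a (k : nat) : nat :=
  let i := k./2 in
  if odd k then (eps k %/ (e i * carry_a i + 1))%N
  else ((eps k + e i * carry_a i) %/ (e i * eps k.+1 * carry_a i + 1))%N.

Definition digit_b (k : nat) : nat :=
  if k is 0 then (1 %/ (e 0 + 1))%N
  else let i := uphalf k in
    if odd k then
      ((eps k + e i * carry_b i) %/ (e i * eps k.+1 * carry_b i + 1))%N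
    else (eps k %/ (e i * carry_b i + 1))%N.

Definition next_digits : nat -> nat :=
  if eps 0 == 0%N then digit_a else digit_b.

End Step.

Definition next_state (e : nat -> bool) (N : nat) : nat :=
  fib_value (next_digits e (fib_digits N)).

Section Chain.
Variables (R : realType) (d : measure_display) (Omega : measurableType d).
Variable P : probability Omega R.

Definition mutually_independent (e : nat -> {RV P >-> bool}) : Prop :=
  forall (s : seq nat) (B : nat -> set bool), uniq s ->
    (P (\bigcap_(i in [set` s]) (e i @^-1` B i)) =
     \prod_(i <- s) P (e i @^-1` B i))%E.

Definition transition_matrix (e : nat -> {RV P >-> bool}) (i j : nat) : R :=
  fine (P [set w | next_state (fun k => e k w) i = j]).

End Chain.

Section Operator.
Variable R : realType.
Implicit Types (S : nat -> nat -> R) (v : nat -> R[i]) (lambda : R[i]).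

(* The ascription to [numFieldType] selects the usual topology of R[i]. *)
Definition operator S v : nat -> R[i] := fun i =>
  limn (series ((fun j => (S i j)%:C * v j) : nat -> (R[i] : numFieldType))).

Definition linf_norm v : \bar R :=
  ereal_sup (range (fun n => (Normc.normc (v n))%:E)).

Definition linf : set (nat -> R[i]) := [set v | (linf_norm v < +oo)%E].

Definition spectrum S : set R[i] :=
  [set lambda | ~ set_bij linf linf
                    (fun v i => operator S v i - lambda * v i)].

Definition approximate_point_spectrum S : set R[i] :=
  [set lambda | exists x : nat -> nat -> R[i],
     [/\ forall n, linf (x n),
         forall n, linf_norm (x n) = 1%E
       & linf_norm (fun i => lambda * x n i - operator S (x n) i)
           @[n --> \oo] --> 0%E]].

Variable p : nat -> R.

Definition r_seq (n : nat) : R := p (n.+1./2).+1.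

Fixpoint qF (n : nat) (lambda : R[i]) : R[i] :=
  match n with
  | 0 => (lambda - (1 - p 1)%:C) / (p 1)%:C
  | n1.+1 =>
    match n1 with
    | 0 => ((p 2)^-1)%:C * qF n1 lambda ^+ 2 - ((p 2)^-1 - 1)%:C
    | n2.+1 => ((r_seq n)^-1)%:C * (qF n1 lambda * qF n2 lambda)
               - ((r_seq n)^-1 - 1)%:C
    end
  end.

Definition bounded_orbit_set : set R[i] :=
  [set lambda | exists M : R, forall n, Normc.normc (qF n lambda) <= M].

End Operator.

(* Main.v *)
Require Import Defs.
From HB Require Import structures.
From mathcomp Require Import all_boot all_order all_algebra.
From mathcomp Require Import all_classical all_reals all_analysis.
From mathcomp Require Import complex zify ring lra.

Set Implicit Arguments.
Unset Strict Implicit.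
Unset Printing Implicit Defensive.

Import Order.TTheory GRing.Theory Num.Theory numFieldNormedType.Exports.

Local Open Scope classical_set_scope.
Local Open Scope ring_scope.

(** Write the Fibonacci digits of a state N as eps_i and let q_N be the product
of the q_(F_i)(lambda) over the digits eps_i = 1. One step from N
leads into a finite list of states: the machine erases the ones of the initial
block 0101...01 (or 101...01, read with an extra 0 in front) in order, one pair
after the other, until some e_i is 0, or it reaches the end of the block, where
the last carry produces N + 1. Two consecutive states of this list
differ in a single digit, so their products differ by a single factor, and
row N of lambda q - S q telescopes: each pair (2j, 2j+1) contributes, up to a
factor, the difference between the two sides of the recursion that defines
q_(F_(2j+2)) ([eigen_defect]). Hence q is a formal eigenvector
([formal_eigenvector]), and since S_(N,N+1) > 0 and N + 1 is the largest state
reached from N, every formal eigenvector is a multiple of q ([formal_kernel]).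

Let lambda be in E. If q is bounded, then it is an eigenvector. If it is
not, let y_n be the product restricted to the digits of index below n, i.e.
with each q_(F_i), i >= n, replaced by 1. At most one pair of a row can
straddle the cut, and all factors beyond it are 1, so lambda y_n - S y_n is
bounded by a constant independent of n ([truncated_eigen_bound]), whereas
the supremum of y_n tends to infinity because y_n = q on [0, F_n[.
Normalizing y_n gives approximate eigenvectors.

A bounded q is also a nonzero element of the kernel of S - lambda. When q is
unbounded, S - lambda is not onto, by a gliding hump: along a rapidly increasing
sequence m_k, the locally finite sum x of 2^-k (y_(m_(k+1)) - y_(m_k)) has a
bounded image under S - lambda, but every formal preimage of this image has the
form x + c q and is unbounded ([hump_unbounded]). *)

(** * Fibonacci digits of a state *)

Lemma admissible_digits N : admissible (fib_digits N).
Proof. by have [? _ ? _] := fib_digitsP N; split. Qed.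

Lemma digit_le1 N i : (fib_digits N i <= 1)%N.
Proof. exact: (admissible_digits N).1. Qed.

Lemma digits_finite N : finite_set [set i | fib_digits N i != 0%N].
Proof. by have [] := fib_digitsP N. Qed.

Lemma finite_support_bound (u : nat -> nat) :
  finite_set [set i | u i != 0%N] ->
  exists n, forall i, (n <= i)%N -> u i = 0%N.
Proof.
move=> /finite_seqP[s us]; exists (\max_(j <- s) j).+1 => i lti.
apply/eqP; apply: contraTT lti => ui; rewrite -leqNgt.
have : [set` s] i by rewrite -us.
by move=> /= si; rewrite (big_rem i) //= leq_maxl.
Qed.

Lemma bound_finite_support (u : nat -> nat) n :
  (forall i, (n <= i)%N -> u i = 0%N) -> finite_set [set i | u i != 0%N].
Proof.
move=> u0; apply: (sub_finite_set _ (finite_II n)) => i /= /eqP ui.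
by rewrite ltnNge; apply/negP => /u0.
Qed.

Lemma fib_value_digits N : fib_value (fib_digits N) = N.
Proof. by have [] := fib_digitsP N. Qed.

Lemma fib_digits_value (u : nat -> nat) n : admissible u ->
  (forall i, (n <= i)%N -> u i = 0%N) -> fib_digits (fib_value u) = u.
Proof.
move=> [le1 nc] u0; apply: (fib_expansion_uniq (fib_digitsP _)).
by split=> //; exact: bound_finite_support u0.
Qed.

Lemma fib_mono m n : (m <= n)%N -> (fib m <= fib n)%N.
Proof.
elim: n => [|[|n] IH]; first by case: m.
  by case: m IH => [|[|m]].
rewrite leq_eqVlt => /orP[/eqP->//|/IH h]; rewrite fibSS; exact: leq_trans h (leq_addr _ _).
Qed.

Lemma digits_lt_fib N n i : (N < fib n)%N -> (n <= i)%N -> fib_digits N i = 0%N.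
Proof.
move=> ltN lei; have [m um] := finite_support_bound (digits_finite N).
apply/eqP; rewrite -leqn0 leqNgt; apply/negP => ui.
have ltim : (i < m)%N by rewrite ltnNge; apply/negP => /um ui0; rewrite ui0 in ui.
have : (fib_digits N i * fib i <= N)%N.
  rewrite -{2}(fib_value_digits N) (fib_valueE um).
  by rewrite (bigD1 (Ordinal ltim)) //= leq_addr.
have := fib_mono lei; have := leq_mul ui (leqnn (fib i)); lia.
Qed.

Lemma digits_ge N i : (N <= i)%N -> fib_digits N i = 0%N.
Proof. by apply: digits_lt_fib; exact: fib_gt. Qed.

(** ** Switching on one digit *)

Definition set_digit (u : nat -> nat) (a : nat) : nat -> nat :=
  fun i => if i == a then 1%N else u i.

(** The elementary relation between consecutive outcomes of one step. *)
Definition switch_on (a M M' : nat) : Prop :=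
  fib_digits M a = 0%N /\ fib_digits M' = set_digit (fib_digits M) a.

Lemma switch_on_value a M M' : switch_on a M M' -> M' = (M + fib a)%N.
Proof.
move=> [M0 dM'].
pose n := maxn M (maxn M' a.+1).
have Mn i : (n <= i)%N -> fib_digits M i = 0%N by move=> h; apply: digits_ge; lia.
have M'n i : (n <= i)%N -> fib_digits M' i = 0%N by move=> h; apply: digits_ge; lia.
have an : (a < n)%N by lia.
rewrite -(fib_value_digits M') -[in RHS](fib_value_digits M).
rewrite (fib_valueE Mn) (fib_valueE M'n).
rewrite (bigD1 (Ordinal an)) //= [in RHS](bigD1 (Ordinal an)) //=.
rewrite M0 dM' /set_digit eqxx mul0n mul1n add0n addnC.
by congr (_ + _)%N; apply: eq_bigr => i /negPf; rewrite -val_eqE /= => ->.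
Qed.

Section DigitWeight.
Variable A : comNzRingType.
Implicit Type G : nat -> A.

(** Indices below N suffice because F_i > i. *)
Definition digit_weight G (N : nat) : A := \prod_(i < N) G i ^+ fib_digits N i.

Lemma digit_weightE G N n : (forall i, (n <= i)%N -> fib_digits N i = 0%N) ->
  digit_weight G N = \prod_(i < n) G i ^+ fib_digits N i.
Proof.
move=> Nn; have widen m k : (forall i, (m <= i)%N -> fib_digits N i = 0%N) ->
    (m <= k)%N ->
    \prod_(i < k) G i ^+ fib_digits N i = \prod_(i < m) G i ^+ fib_digits N i.
  move=> Nm lemk; rewrite -!(big_mkord xpredT (fun i => G i ^+ fib_digits N i)).
  rewrite (big_cat_nat _ lemk) //= [X in _ * X]big_nat_cond [X in _ * X]big1 ?mulr1 // => i.
  by rewrite andbT => /andP[/Nm -> _].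
rewrite /digit_weight; case: (leqP n N) => [|/ltnW] h; first exact: widen.
by rewrite (widen N n) // => i; exact: digits_ge.
Qed.

Lemma digit_weight0 G : digit_weight G 0 = 1.
Proof. by rewrite /digit_weight big_ord0. Qed.

Lemma switch_on_weight G a M M' :
  switch_on a M M' -> digit_weight G M' = G a * digit_weight G M.
Proof.
move=> [M0 dM'].
pose n := maxn M (maxn M' a.+1).
have Mn i : (n <= i)%N -> fib_digits M i = 0%N by move=> h; apply: digits_ge; lia.
have M'n i : (n <= i)%N -> fib_digits M' i = 0%N by move=> h; apply: digits_ge; lia.
have an : (a < n)%N by lia.
rewrite (digit_weightE G Mn) (digit_weightE G M'n).
rewrite (bigD1 (Ordinal an)) //= [in RHS](bigD1 (Ordinal an)) //=.
rewrite M0 dM' /set_digit eqxx expr0 expr1 mul1r.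
by congr (_ * _); apply: eq_bigr => i /negPf; rewrite -val_eqE /= => ->.
Qed.

End DigitWeight.

(** * The possible moves out of a state *)

Section Moves.
Variable N : nat.

(** A state whose digit 0 is 1 is read with an extra digit 0 in front: its pairs
(2i-1, 2i) then become pairs (2i, 2i+1), so that cases (a) and (b) of the machine
are one. The new position 0 is given the index 0 too, by truncated subtraction,
as if F_(-1) = F_0 = 1; the Fibonacci recursion then holds from the start. *)
Definition offset : bool := fib_digits N 0 != 0%N.

Definition aligned (i : nat) : nat :=
  if (i < offset)%N then 0%N else fib_digits N (i - offset).

Lemma alignedE k : aligned (k + offset) = fib_digits N k.
Proof. by rewrite /aligned ltnNge leq_addl addnK. Qed.

Lemma aligned_le1 i : (aligned i <= 1)%N.
Proof. by rewrite /aligned; case: ifP => // _; exact: digit_le1. Qed.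

Lemma aligned_nc i : ~ (aligned i = 1%N /\ aligned i.+1 = 1%N).
Proof.
rewrite /aligned; case: (ltnP i offset) => [_ []//|h].
rewrite ltnNge (leqW h) subSn //; exact: (admissible_digits N).2.
Qed.

Lemma aligned0 : aligned 0 = 0%N.
Proof. by rewrite /aligned /offset; case: eqP => //= ->. Qed.

Lemma aligned_ge i : (N.+1 <= i)%N -> aligned i = 0%N.
Proof.
by move=> h; rewrite /aligned; case: ifP => // _; apply: digits_ge; case: offset; lia.
Qed.

Lemma chain_stops : exists k, aligned k.*2.+1 == 0%N.
Proof. by exists N; rewrite aligned_ge //; lia. Qed.

(** The number of full pairs 01 at the beginning of the aligned digits. *)
Definition chain_length : nat := ex_minn chain_stops.
Local Notation K := chain_length.

Lemma aligned_stop : aligned K.*2.+1 = 0%N.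
Proof. by rewrite /K; case: ex_minnP => k /eqP. Qed.

Lemma aligned_chain j : (j < K)%N -> aligned j.*2.+1 = 1%N.
Proof.
rewrite /K; case: ex_minnP => k _ min ltjk.
have : aligned j.*2.+1 != 0%N by apply/negP => /min; lia.
by have := aligned_le1 j.*2.+1; lia.
Qed.

Lemma offset_le_chain : (offset <= K)%N.
Proof.
case b: offset => //; rewrite lt0n; apply/eqP => K0; have := aligned_stop.
by rewrite K0 /aligned b /=; move: b; rewrite /offset => /eqP.
Qed.

(** The aligned digits when the first j attempts succeed and the next one fails or
lies beyond the chain: the first j pairs are erased, and if j exceeds the chain
length the last carry has written a 1 at position 2K. *)
Definition carried (j k : nat) : nat :=
  if (k./2 < j)%N then (k == K.*2) : nat else aligned k.

(** Inside the chain this is forced by the digit 1 at position 2j-1. *)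
Lemma even_digit0 j : (j <= K)%N -> aligned j.*2 = 0%N.
Proof.
case: j => [_|j ltj]; first exact: aligned0.
have := @aligned_nc j.*2.+1; rewrite aligned_chain // -doubleS.
by have := aligned_le1 (j.+1.*2); case: (aligned _) => [|[|]] // _ [].
Qed.

(** Inside the chain the carry survives as long as all trials succeed, and the
digit 0 at position 2K+1 kills it. *)
Lemma carry_aE (e : nat -> bool) j : (j <= K.+1)%N ->
  (forall i, (i < j)%N -> e i) -> ((j <= K)%N -> ~~ e j) ->
  forall i, (e i * carry_a e aligned i)%N = (i < j)%N.
Proof.
move=> jK ej nej; elim=> [|i IH] /=.
  by rewrite muln1; case: j jK ej nej => [|j] jK ej nej; [rewrite (negPf (nej _))|rewrite ej].
rewrite IH; case: (ltngtP i K) => [ltiK|ltKi|->].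
- rewrite aligned_chain // muln1; case: (ltngtP i.+1 j) => [lt|gt|eqj].
  + by rewrite ej // ltnW.
  + by rewrite muln0.
  + by rewrite eqj (negPf (nej _)) // -eqj.
- have ->: (i < j)%N = false by lia.
  rewrite muln0.
  by have -> : (i.+1 < j)%N = false by lia.
- by rewrite aligned_stop muln0 muln0; have -> : (K.+1 < j)%N = false by lia.
Qed.

Lemma digit_aE (e : nat -> bool) j : (j <= K.+1)%N ->
  (forall i, (i < j)%N -> e i) -> ((j <= K)%N -> ~~ e j) ->
  digit_a e aligned =1 carried j.
Proof.
move=> jK ej nej k; rewrite /digit_a /carried.
have [m [b ->]] : exists m (b : bool), k = (b + m.*2)%N.
  by exists k./2, (odd k); rewrite odd_double_half.
have -> : (nat_of_bool b + m.*2)./2 = m by case: b; lia.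
have -> : odd (nat_of_bool b + m.*2) = b by case: b; lia.
rewrite mulnAC (carry_aE jK ej nej).
case: b => /=; rewrite ?add1n ?add0n.
  case: ifP => _; last by rewrite divn1.
  rewrite divn_small; last by have := aligned_le1 (m.*2.+1); lia.
  by have -> : (m.*2.+1 == K.*2) = false by lia.
case: ifP => ltm; last by rewrite mul0n addn0 divn1.
rewrite mul1n even_digit0; last lia.
case: (ltngtP m K) => [ltmK|?|->]; [|lia|by rewrite aligned_stop eqxx].
by rewrite aligned_chain //=; have -> : (m.*2 == K.*2) = false by lia.
Qed.

Lemma carried_le1 j k : (carried j k <= 1)%N.
Proof. by rewrite /carried; case: ifP => _; [case: eqP|exact: aligned_le1]. Qed.

Lemma carried_nc j k : (j <= K.+1)%N -> ~ (carried j k = 1%N /\ carried j k.+1 = 1%N).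
Proof.
move=> jK; rewrite /carried; case: (ltnP k./2 j) => h1; case: (ltnP k.+1./2 j) => h2.
- by case: eqP; case: eqP => // ? ? []; lia.
- by case: eqP => [|_ []//]; lia.
- lia.
- exact: aligned_nc.
Qed.

Lemma carriedS j : (j < K)%N -> carried j =1 set_digit (carried j.+1) j.*2.+1.
Proof.
move=> jK k; rewrite /set_digit /carried; have [->|nk] := eqVneq k j.*2.+1.
  have -> : ((j.*2.+1)./2 < j)%N = false by lia.
  exact: aligned_chain.
case: (ltnP k./2 j) => h1; first by have -> : (k./2 < j.+1)%N by lia.
case: (ltnP k./2 j.+1) => h2 //.
have -> : k = j.*2 by lia.
by rewrite even_digit0 ?(ltnW jK) //; have -> : (j.*2 == K.*2) = false by lia.
Qed.

Lemma carried_last : carried K.+1 =1 set_digit (carried K) K.*2.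
Proof.
move=> k; rewrite /set_digit /carried; have [->|nk] := eqVneq k K.*2.
  by have -> : (K.*2./2 < K.+1)%N by lia.
case: (ltnP k./2 K) => h1; first by have -> : (k./2 < K.+1)%N by lia.
case: (ltnP k./2 K.+1) => h2 //.
have -> : k = K.*2.+1 by lia.
by rewrite aligned_stop.
Qed.

(** In case (b) the extra leading position is dropped again; it holds 0 because the
chain then has positive length. *)
Definition successor (j : nat) : nat :=
  fib_value (fun k => carried j (k + offset)).

Lemma digits_successor j : (j <= K.+1)%N ->
  fib_digits (successor j) = fun k => carried j (k + offset).
Proof.
move=> jK; apply: (@fib_digits_value _ (N.+1 + K.*2.+1)); first split=> [i|i].
- exact: carried_le1.
- by rewrite addSn; exact: carried_nc.
- move=> i h; rewrite /carried aligned_ge; last by case: offset; lia.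
  by case: ifP => // _; apply/eqP; rewrite eqb0; case: offset; lia.
Qed.

Lemma successor0 : successor 0 = N.
Proof.
rewrite -[RHS]fib_value_digits /successor; congr fib_value; apply/funext => k.
by rewrite /carried alignedE.
Qed.

(** Case (b) for the digits of N is case (a) for the aligned digits, carries
included. *)
Lemma next_state_successor (e : nat -> bool) j : (j <= K.+1)%N ->
  (forall i, (i < j)%N -> e i) -> ((j <= K)%N -> ~~ e j) ->
  next_state e N = successor j.
Proof.
move=> jK ej nej; rewrite /next_state /successor; congr fib_value; apply/funext => k.
have dE := digit_aE jK ej nej.
rewrite -dE /next_digits; case: eqP => [N0|/eqP N1].
  have b0 : offset = false by rewrite /offset N0.
  rewrite b0 addn0; congr (digit_a _ _ _); apply/funext => i.
  by rewrite -alignedE b0 addn0.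
have b1 : offset = true by rewrite /offset.
have dN i : fib_digits N i = aligned i.+1 by rewrite -alignedE b1 addn1.
have carryE i : carry_b e (fib_digits N) i = carry_a e aligned i.
  elim: i => [//|i IH] /=; case: i IH => [_|i IH].
    by rewrite -dN /=; have := digit_le1 N 0; case: (fib_digits N 0) N1 => [|[|]] // _ _;
      case: (e 0%N).
  by rewrite IH dN.
rewrite b1 addn1; case: k => [|k].
  have -> : digit_b e (fib_digits N) 0 = (1 %/ (e 0%N + 1))%N by [].
  rewrite /digit_a /= -dN muln1.
  by have := digit_le1 N 0; case: (fib_digits N 0) N1 => [|[|]].
rewrite /digit_b /digit_a -!dN -carryE.
have -> : odd k.+2 = ~~ odd k.+1 by [].
by have -> : k.+2./2 = uphalf k.+1 by []; case: (odd k.+1).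
Qed.

Lemma successor_switch j : (j < K)%N ->
  switch_on (j.*2.+1 - offset) (successor j.+1) (successor j).
Proof.
move=> jK; have b1 : (offset <= 1)%N by case: offset.
split; rewrite !digits_successor; try lia.
  rewrite subnK ?(leq_trans b1) // /carried.
  have -> : (j.*2.+1./2 < j.+1)%N by lia.
  by have -> : (j.*2.+1 == K.*2) = false by lia.
apply/funext => k; rewrite carriedS // /set_digit.
by congr (if _ then _ else _); lia.
Qed.

Lemma successor_switch_last : switch_on (K.*2 - offset) (successor K) (successor K.+1).
Proof.
have b1 := offset_le_chain.
split; rewrite !digits_successor; try lia.
  rewrite subnK; last lia.
  by rewrite /carried ltnNge doubleK leqnn /= even_digit0.
apply/funext => k; rewrite carried_last /set_digit.
by congr (if _ then _ else _); lia.
Qed.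

Lemma successor_low_digits j i : (j <= K)%N -> (i + offset < j.*2)%N ->
  fib_digits (successor j) i = 0%N.
Proof.
move=> jK lti; rewrite digits_successor; last lia.
rewrite /carried; have -> : ((i + offset)./2 < j)%N by lia.
by have -> : (i + offset == K.*2)%N = false by lia.
Qed.

Lemma fib_offset j : fib (j.+2 - offset) = (fib (j.+1 - offset) + fib (j - offset))%N.
Proof. by case: offset; rewrite ?subn0 ?subn1 //; case: j. Qed.

(** Erasing the digit 2j+1 is compensated by F_(2j+2) = F_(2j+1) + F_(2j). *)
Lemma successor_value j : (j <= K)%N -> (successor j + fib (j.*2 - offset) = N.+1)%N.
Proof.
elim: j => [_|j IH jK]; first by rewrite successor0 addn1.
rewrite -[RHS]IH ?(ltnW jK) // doubleS fib_offset (switch_on_value (successor_switch jK)).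
by rewrite !addnA.
Qed.

Lemma successor_le j : (j <= K)%N -> (successor j <= N)%N.
Proof. by move=> /successor_value; have := fib_gt0 (j.*2 - offset); lia. Qed.

Lemma successor_last : successor K.+1 = N.+1.
Proof. by rewrite (switch_on_value successor_switch_last) successor_value. Qed.

End Moves.

(** * Transition probabilities *)

Section Probability.
Variables (R : realType) (p : nat -> R).
Variables (d : measure_display) (Omega : measurableType d) (P : probability Omega R).
Variable e : nat -> {RV P >-> bool}.
Hypothesis he : forall i, P [set w | e i w] = (p i.+1)%:E.
Hypothesis hind : mutually_independent e.

Definition success_prob (j : nat) : R := \prod_(i < j) p i.+1.

Lemma success_prob0 : success_prob 0 = 1.
Proof. by rewrite /success_prob big_ord0. Qed.

Lemma success_probS j : success_prob j.+1 = success_prob j * p j.+1.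
Proof. by rewrite /success_prob big_ord_recr. Qed.

Definition successes (j : nat) : set Omega :=
  [set w | forall i, (i < j)%N -> e i w].

Lemma successesE j :
  successes j = \bigcap_(i in [set` iota 0 j]) (e i @^-1` [set true]).
Proof.
apply/seteqP; split=> w /= h i; first by rewrite /= mem_iota => /h.
by move=> lti; apply: (h i); rewrite /= mem_iota.
Qed.

Lemma successes_measurable j : measurable (successes j).
Proof.
rewrite successesE; apply: fin_bigcap_measurable; first exact: finite_seq.
by move=> i _; exact: measurable_funPTI.
Qed.

Lemma successes_prob j : P (successes j) = (success_prob j)%:E.
Proof.
rewrite successesE (hind (fun=> [set true]) (iota_uniq 0 j)).
under eq_bigr => i _.
  have -> : e i @^-1` [set true] = [set w | e i w] by [].
  rewrite he; over.
rewrite prodEFin; congr EFin; rewrite /success_prob.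
by rewrite -[in LHS](subn0 j) -/(index_iota 0 j) big_mkord.
Qed.

(** The first failure occurs at trial j, or trials 0, ..., K all succeed when
j = K + 1. *)
Definition outcome (K j : nat) : set Omega :=
  if (j <= K)%N then successes j `\` successes j.+1 else successes j.

Definition outcome_prob (K j : nat) : R :=
  if (j <= K)%N then success_prob j - success_prob j.+1 else success_prob j.

Lemma outcome_measurable K j : measurable (outcome K j).
Proof.
rewrite /outcome; case: ifP => _; last exact: successes_measurable.
by apply: measurableD; exact: successes_measurable.
Qed.

Lemma successesS j : successes j.+1 `<=` successes j.
Proof. by move=> w h i lti; apply: h; exact: ltnW. Qed.

Lemma outcome_probE K j : P (outcome K j) = (outcome_prob K j)%:E.
Proof.
rewrite /outcome /outcome_prob; case: ifP => _; last exact: successes_prob.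
rewrite measureD; [|exact: successes_measurable..|].
  rewrite setIidr; last exact: successesS.
  by rewrite EFinB; congr (_ - _)%E; exact: successes_prob.
by apply: (le_lt_trans (probability_le1 _ _)); [exact: successes_measurable|exact: ltry].
Qed.

Lemma outcomeP K j w : (j <= K.+1)%N ->
  outcome K j w <-> (forall i, (i < j)%N -> e i w) /\ ((j <= K)%N -> ~~ e j w).
Proof.
move=> jK; rewrite /outcome; case: ifP => leK; last by split=> [h|[]]; [split|].
split=> [[h nh]|[h nej]].
  split=> // _; apply/negP => ej; apply: nh => i; rewrite ltnS leq_eqVlt.
  by case/orP => [/eqP->//|]; exact: h.
by split=> // hS; have := nej isT; rewrite hS.
Qed.

Lemma outcome_exists K w : exists2 j, (j <= K.+1)%N & outcome K j w.
Proof.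
pose j := find (fun i => ~~ e i w) (iota 0 K.+1).
have jK : (j <= K.+1)%N by rewrite -[X in (_ <= X)%N](size_iota 0) find_size.
exists j => //; apply/outcomeP => //; split=> [i lti|lej].
  have := before_find 0%N lti; rewrite nth_iota ?add0n; last by lia.
  by move/negbFE.
have : has (fun i => ~~ e i w) (iota 0 K.+1) by rewrite has_find size_iota.
by move/(nth_find 0%N); rewrite nth_iota ?add0n.
Qed.

Lemma outcome_uniq K i j w : (i <= K.+1)%N -> (j <= K.+1)%N ->
  outcome K i w -> outcome K j w -> i = j.
Proof.
move=> iK jK /(outcomeP _ iK)[hi ni] /(outcomeP _ jK)[hj nj].
case: (ltngtP i j) => // lt; exfalso.
  by have := ni (leq_trans lt jK); rewrite hj.
by have := nj (leq_trans lt iK); rewrite hi.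
Qed.

(** The outcomes partition the sample space, and each determines the next state. *)
Lemma transition_matrixE N k : transition_matrix e N k =
  \sum_(j < (chain_length N).+2 | successor N j == k) outcome_prob (chain_length N) j.
Proof.
set K := chain_length N; rewrite /transition_matrix.
have -> : [set w | next_state (fun i => e i w) N = k] =
    \big[setU/set0]_(j < K.+2 | successor N j == k) outcome K j.
  apply/seteqP; split=> w /=.
    have [j jK ow] := outcome_exists K w; have [ej nej] := (outcomeP w jK).1 ow.
    rewrite (next_state_successor jK ej nej) => /eqP mk.
    rewrite -(bigcup_pred (fun j : 'I_K.+2 => successor N j == k)).
    by exists (@Ordinal K.+2 j jK).
  rewrite -(bigcup_pred (fun j : 'I_K.+2 => successor N j == k)) => -[j /= /eqP <- ow].
  have jK : (j <= K.+1)%N := ltn_ord j.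
  have [ej nej] := (outcomeP w jK).1 ow.
  exact: next_state_successor jK ej nej.
rewrite measure_bigsetU_ord_cond; first last.
- move=> i j _ _ [w [oi oj]]; apply/val_inj.
  exact: (@outcome_uniq K _ _ w (ltn_ord i) (ltn_ord j) oi oj).
- by move=> j _; exact: outcome_measurable.
rewrite (eq_bigr (fun j : 'I__ => (outcome_prob K j)%:E)) ?sumEFin // => j _.
exact: outcome_probE.
Qed.

End Probability.

(** * The transition operator, row by row *)

Section TransitionOperator.
Local Open Scope complex_scope.
Variables (R : realType) (p : nat -> R).
Variables (d : measure_display) (Omega : measurableType d) (P : probability Omega R).
Variable e : nat -> {RV P >-> bool}.
Hypothesis he : forall i, P [set w | e i w] = (p i.+1)%:E.
Hypothesis hind : mutually_independent e.
Local Notation S := (operator (transition_matrix e)).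
Local Notation K := chain_length.
Local Notation pi := (success_prob p).

(** The series is eventually constant, since row N is supported in [0, N+1]. *)
Lemma operator_sum v N :
  S v N = \sum_(j < (K N).+2) (outcome_prob p (K N) j)%:C * v (successor N j).
Proof.
rewrite /operator.
suff h : \forall n \near \oo,
    series ((fun j => (transition_matrix e N j)%:C * v j)
            : nat -> (R[i] : numFieldType)) n =
    \sum_(j < (K N).+2) (outcome_prob p (K N) j)%:C * v (successor N j).
  apply: lim_near_cst h; exact: norm_hausdorff.
have entryE k : (transition_matrix e N k)%:C * v k =
    \sum_(j < (K N).+2 | successor N j == k) (outcome_prob p (K N) j)%:C * v (successor N j).
  rewrite (transition_matrixE he hind) rmorph_sum /= mulr_suml.
  by apply: eq_bigr => j /eqP ->.
exists N.+2 => // n leNn; rewrite seriesEord.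
transitivity (\sum_(k < n) \sum_(j < (K N).+2 | successor N j == k)
    (outcome_prob p (K N) j)%:C * v (successor N j)).
  by apply: eq_bigr => k _; exact: entryE.
rewrite (exchange_big_dep xpredT) //=; apply: eq_bigr => j _.
have ltmn : (successor N j < n)%N.
  apply: leq_trans leNn; rewrite ltnS.
  have : (j <= (K N).+1)%N by rewrite -ltnS.
  rewrite leq_eqVlt => /orP[/eqP->|]; first by rewrite successor_last.
  by rewrite ltnS => /successor_le; lia.
by rewrite (big_pred1 (Ordinal ltmn)).
Qed.

Lemma operatorE v N : S v N =
  \sum_(j < (K N).+1) (pi j - pi j.+1)%:C * v (successor N j) + (pi (K N).+1)%:C * v N.+1.
Proof.
rewrite operator_sum big_ord_recr /= successor_last /outcome_prob ltnn; congr (_ + _).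
by apply: eq_bigr => j _; rewrite -ltnS ltn_ord.
Qed.

(** The amount by which G fails the recursion of the q_(F_n) at index 2j+2
(2j+1 if s), for a pair of digits read with the shift s. *)
Definition defect (s : bool) (G : nat -> R[i]) (j : nat) : R[i] :=
  G (j.*2 - s)%N * G (j.*2.+1 - s)%N
  - ((p j.+2)%:C * G (j.*2.+2 - s)%N + (1 - p j.+2)%:C).

(** With x the digit weight and s_j the j-th state, x(s_j) = G_(2j+1) x(s_(j+1)).
So lambda x(N) minus the first term of the row is p_1 G_0 x(s_0), and subtracting
the next term turns p_1 ... p_(j+1) G_(2j) x(s_j) into the same expression for j + 1
plus a multiple of one defect. At the end of the chain the expression is the term
of N + 1. *)
Lemma eigen_defect lambda G N : lambda = (1 - p 1)%:C + (p 1)%:C * G 0%N ->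
  lambda * digit_weight G N - S (digit_weight G) N =
  \sum_(j < K N) (pi j.+1)%:C * defect (offset N) G j * digit_weight G (successor N j.+1).
Proof.
move=> hl; set x := digit_weight G.
have partial m : (m <= K N)%N ->
    lambda * x N - \sum_(j < m.+1) (pi j - pi j.+1)%:C * x (successor N j) =
    (pi m.+1)%:C * G (m.*2 - offset N)%N * x (successor N m) +
    \sum_(j < m) (pi j.+1)%:C * defect (offset N) G j * x (successor N j.+1).
  elim: m => [_|m IH ltm].
    rewrite big_ord0 big_ord1 /= successor0 success_probS success_prob0 mul1r hl sub0n.
    by rewrite addr0; ring.
  rewrite big_ord_recr /= opprD addrA IH ?(ltnW ltm) // [in RHS]big_ord_recr /=.
  rewrite /x (switch_on_weight G (successor_switch ltm)) -/x /defect doubleS.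
  rewrite (success_probS _ m.+1) !rmorphB !rmorphM /= rmorph1.
  ring.
rewrite operatorE opprD addrA partial // -(successor_last N).
rewrite /x (switch_on_weight G (successor_switch_last N)) -/x.
ring.
Qed.

End TransitionOperator.

(** * The complex modulus and the supremum norm *)

Section Modulus.
Local Open Scope complex_scope.
Variable R : realType.
Implicit Types (x y : R[i]) (v : nat -> R[i]).
Local Notation nc := (@Normc.normc R).

Lemma ncD x y : nc (x + y) <= nc x + nc y.
Proof. exact: le_normcD. Qed.

Lemma nc_ge0 x : 0 <= nc x.
Proof. by case: x => a b; exact: sqrtr_ge0. Qed.

Lemma ncN x : nc (- x) = nc x.
Proof. exact: normcN. Qed.

Lemma ncB x y : nc (x - y) <= nc x + nc y.
Proof. by rewrite -[nc y]ncN; exact: ncD. Qed.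

Lemma nc_real (r : R) : nc r%:C = `|r|.
Proof. by rewrite /= expr0n addr0 sqrtr_sqr. Qed.

Lemma nc_realM (r : R) x : 0 <= r -> nc (r%:C * x) = r * nc x.
Proof. by move=> r0; rewrite Normc.normcM nc_real ger0_norm. Qed.

Lemma nc_sum (I : Type) (s : seq I) (Q : pred I) (F : I -> R[i]) :
  nc (\sum_(i <- s | Q i) F i) <= \sum_(i <- s | Q i) nc (F i).
Proof.
elim/big_rec2: _ => [|i a b _ h]; first by rewrite Normc.normc0.
by apply: (le_trans (ncD _ _)); rewrite lerD2l.
Qed.

Lemma linf_norm_le v (B : R) :
  (linf_norm v <= B%:E)%E <-> forall i, nc (v i) <= B.
Proof.
split=> [h i|h]; last by apply: ge_ereal_sup => _ [i _ <-]; rewrite lee_fin.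
by rewrite -lee_fin; apply: le_trans h; apply: ereal_sup_ubound; exists i.
Qed.

Lemma nc_le_linf_norm v i : ((nc (v i))%:E <= linf_norm v)%E.
Proof. by apply: ereal_sup_ubound; exists i. Qed.

Lemma linf_norm_ge0 v : (0 <= linf_norm v)%E.
Proof. by apply: le_trans (nc_le_linf_norm v 0); rewrite lee_fin nc_ge0. Qed.

Lemma linfP v : linf v <-> exists B, forall i, nc (v i) <= B.
Proof.
split=> [vfin|[B /linf_norm_le h]]; last exact: le_lt_trans h (ltry _).
exists (fine (linf_norm v)); apply/linf_norm_le.
by rewrite fineK // ge0_fin_numE // linf_norm_ge0.
Qed.

(** Scaling by the inverse of the norm; the bound by 1 is immediate, and a smaller
norm would give a smaller bound for v. *)
Lemma linf_norm_normalized v : linf v -> (exists i, v i != 0) ->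
  exists a : R, [/\ 0 < a, forall i, nc (v i) <= a
    & linf_norm (fun i => (a^-1)%:C * v i) = 1%E].
Proof.
move=> vfin [i0 vi0]; pose a := fine (linf_norm v).
have aE : linf_norm v = a%:E by rewrite fineK // ge0_fin_numE // linf_norm_ge0.
have le_a i : nc (v i) <= a by have := nc_le_linf_norm v i; rewrite aE lee_fin.
have a0 : 0 < a.
  apply: lt_le_trans (le_a i0); rewrite lt_neqAle nc_ge0 andbT eq_sym.
  by apply: contra vi0 => /eqP/Normc.eq0_normc->.
exists a; split=> //; have ai0 : 0 <= a^-1 by rewrite invr_ge0 ltW.
have le1 : (linf_norm (fun i => (a^-1)%:C * v i)%R <= 1%:E)%E.
  by apply/linf_norm_le => i; rewrite nc_realM // mulrC ler_pdivrMr // mul1r.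
apply/eqP; rewrite eq_le le1 /=.
set L := linf_norm _ in le1 *; have L0 : (0 <= L)%E by exact: linf_norm_ge0.
have Lfin : L \is a fin_num by rewrite ge0_fin_numE // (le_lt_trans le1) ?ltry.
rewrite -(fineK Lfin) lee_fin -(ler_pM2l a0) mulr1 -lee_fin -aE.
apply/linf_norm_le => i; have : (L <= (fine L)%:E)%E by rewrite fineK.
move/linf_norm_le/(_ i); rewrite nc_realM // mulrC ler_pdivrMr // mulrC.
by rewrite [a * _]mulrC [fine L * _]mulrC.
Qed.

End Modulus.

(** * The formal eigenvector and its truncations *)

Section Eigenvectors.
Local Open Scope complex_scope.
Variables (R : realType) (p : nat -> R).
Hypothesis hp : forall i, (1 <= i)%N -> 0 < p i <= 1.
Variable lambda : R[i].
Local Notation nc := (@Normc.normc R).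
Local Notation q := (fun i => qF p i lambda).

Lemma p_neq0 i : (p i.+1)%:C != 0 :> R[i].
Proof.
have /andP[p0 _] := hp (ltn0Sn i).
by rewrite (inj_eq (@complexI R) (p i.+1) 0) gt_eqF.
Qed.

Lemma success_prob_gt0 j : 0 < success_prob p j.
Proof. by apply: prodr_gt0 => i _; have /andP[] := hp (ltn0Sn i). Qed.

Lemma success_prob_le1 j : success_prob p j <= 1.
Proof. by apply: prodr_ile1 => i _; have /andP[/ltW -> ->] := hp (ltn0Sn i). Qed.

Lemma qF0_eigen : lambda = (1 - p 1)%:C + (p 1)%:C * qF p 0 lambda.
Proof. by rewrite /= mulrC divfK ?p_neq0 // addrC subrK. Qed.

(** The recursion of the q_(F_n), solved for the product of the two earlier terms. *)
Lemma qF_rec_defect i (a b : R[i]) :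
  a * b - ((p i.+1)%:C * (((p i.+1)^-1)%:C * (b * a) - ((p i.+1)^-1 - 1)%:C)
           + (1 - p i.+1)%:C) = 0.
Proof.
have -> : ((p i.+1)^-1)%:C = ((p i.+1)%:C)^-1 :> R[i] by exact: fmorphV.
rewrite !rmorphB /= rmorph1.
have -> : ((p i.+1)^-1)%:C = ((p i.+1)%:C)^-1 :> R[i] by exact: fmorphV.
move: (p_neq0 i); move: ((p i.+1)%:C) => r r0.
by field.
Qed.

Lemma r_seq_even j : r_seq p j.*2.+2 = p j.+2.
Proof. by rewrite /r_seq; congr (p _.+1); lia. Qed.

Lemma r_seq_odd j : r_seq p j.*2.+3 = p j.+3.
Proof. by rewrite /r_seq; congr (p _.+1); lia. Qed.

Lemma qF_SS n : qF p n.+2 lambda =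
  ((r_seq p n.+2)^-1)%:C * (qF p n.+1 lambda * qF p n lambda)
  - ((r_seq p n.+2)^-1 - 1)%:C.
Proof. by []. Qed.

Lemma qF_defect s j : defect p s q j = 0.
Proof.
rewrite /defect; case: s.
  case: j => [|j]; first exact: (qF_rec_defect 1).
  rewrite doubleS !subSS !subn0.
  by rewrite (qF_SS j.*2.+1) r_seq_odd; exact: qF_rec_defect.
by rewrite !subn0 (qF_SS j.*2) r_seq_even; exact: qF_rec_defect.
Qed.

(** A factor 1 makes a digit of index at least n invisible to the weight. *)
Definition truncated (n i : nat) : R[i] := if (i < n)%N then qF p i lambda else 1.

Lemma digit_weight_truncated n N : digit_weight (truncated n) N =
  \prod_(i < n) qF p i lambda ^+ fib_digits N i.
Proof.
have Nn i : (maxn n N <= i)%N -> fib_digits N i = 0%N by move=> h; apply: digits_ge; lia.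
rewrite (digit_weightE _ Nn).
rewrite -(big_mkord xpredT (fun i => truncated n i ^+ fib_digits N i)).
rewrite (@big_cat_nat _ _ _ n) //= ?leq_maxl // [X in _ * X]big_nat_cond [X in _ * X]big1 ?mulr1.
  by rewrite big_mkord; apply: eq_bigr => i _; rewrite /truncated ltn_ord.
by move=> i; rewrite andbT => /andP[h _]; rewrite /truncated ltnNge h expr1n.
Qed.

Lemma digit_weight_truncated_small n N : (N < fib n)%N ->
  digit_weight (truncated n) N = digit_weight q N.
Proof.
move=> ltN; rewrite digit_weight_truncated (@digit_weightE _ q N n) //.
by move=> i; exact: digits_lt_fib.
Qed.

Variable M : R.
Hypothesis M1 : 1 <= M.
Hypothesis qM : forall i, nc (qF p i lambda) <= M.

Lemma digit_weight_truncated_bound n N : nc (digit_weight (truncated n) N) <= M ^+ n.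
Proof.
rewrite digit_weight_truncated; elim: n => [|n IH].
  by rewrite big_ord0 expr0 Normc.normc1.
rewrite big_ord_recr /= exprSr Normc.normcM; apply: ler_pM; rewrite ?nc_ge0 //.
have := digit_le1 N n; case: (fib_digits N n) => [|[|//]] _; last by rewrite expr1.
by rewrite expr0 Normc.normc1.
Qed.

Lemma truncated_defect_bound n s j :
  nc (defect p s (truncated n) j) <= M * M + M + 1.
Proof.
have /andP[p0 p1] := hp (ltn0Sn j.+1).
have tM i : nc (truncated n i) <= M by rewrite /truncated; case: ifP; rewrite ?Normc.normc1.
rewrite /defect; apply: (le_trans (ncB _ _)); rewrite -addrA; apply: lerD.
  by rewrite Normc.normcM; apply: ler_pM; rewrite ?nc_ge0.
apply: (le_trans (ncD _ _)); apply: lerD.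
  rewrite nc_realM ?(ltW p0) //; apply: le_trans (tM (j.*2.+2 - s)%N).
  by rewrite ler_piMl ?nc_ge0.
by rewrite nc_real ger0_norm ?subr_ge0 // gerBl (ltW p0).
Qed.

Lemma truncated_defect_low n (s : bool) j : (j.*2.+2 - s < n)%N ->
  defect p s (truncated n) j = 0.
Proof.
move=> h; rewrite -(qF_defect s j) /defect /truncated.
by rewrite !ifT //; lia.
Qed.

Lemma truncated_defect_high n (s : bool) j : (n <= j.*2 - s)%N ->
  defect p s (truncated n) j = 0.
Proof.
move=> h; rewrite /defect /truncated.
rewrite !ifF; try lia.
by rewrite !mulr1 -rmorphD [p _ + _]addrC subrK rmorph1 subrr.
Qed.

Lemma digit_weight_truncated_high n N :
  (forall i, (i < n)%N -> fib_digits N i = 0%N) -> digit_weight (truncated n) N = 1.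
Proof.
move=> N0; rewrite digit_weight_truncated; apply: big1 => i _.
by rewrite N0 ?expr0.
Qed.

Section Operator.
Variables (d : measure_display) (Omega : measurableType d) (P : probability Omega R).
Variable e : nat -> {RV P >-> bool}.
Hypothesis he : forall i, P [set w | e i w] = (p i.+1)%:E.
Hypothesis hind : mutually_independent e.
Local Notation S := (operator (transition_matrix e)).

Lemma formal_eigenvector N :
  lambda * digit_weight q N - S (digit_weight q) N = 0.
Proof.
rewrite (eigen_defect he hind); last exact: qF0_eigen.
by apply: big1 => j _; rewrite qF_defect mulr0 mul0r.
Qed.

(** Below the cut the defect is 0 by the recursion, above it because all factors are
1. The pair that straddles the cut, if there is one, leads to a state without
digits below the cut, whose weight is 1, so only the size of its defect counts. *)
Lemma truncated_eigen_bound n N : (0 < n)%N ->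
  nc (lambda * digit_weight (truncated n) N - S (digit_weight (truncated n)) N)
    <= M * M + M + 1.
Proof.
move=> n0; have C0 : 0 <= M * M + M + 1 by nra.
rewrite (eigen_defect he hind); last first.
  by rewrite /truncated n0; exact: qF0_eigen.
(* The index j with 2j - s < n <= 2j + 2 - s. *)
set s := offset N; pose j0 := (n + s).-1./2.
have other (j : nat) : j != j0 -> (j < chain_length N)%N ->
    (success_prob p j.+1)%:C * defect p s (truncated n) j *
      digit_weight (truncated n) (successor N j.+1) = 0.
  move=> nej _; case: (ltnP (j.*2.+2 - s) n) => h.
    by rewrite truncated_defect_low // mulr0 mul0r.
  by rewrite truncated_defect_high ?mulr0 ?mul0r //; rewrite /j0 in nej; lia.
case: (ltnP j0 (chain_length N)) => ltj; last first.
  by rewrite big1 ?Normc.normc0 // => j _; apply: other => //; have := ltn_ord j; lia.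
rewrite (bigD1 (Ordinal ltj)) //= [X in _ + X]big1 ?addr0; last first.
  by move=> j nej; apply: other.
rewrite digit_weight_truncated_high ?mulr1.
  rewrite nc_realM ?(ltW (success_prob_gt0 _)) //.
  apply: le_trans (truncated_defect_bound n s j0).
  by rewrite ler_piMl ?nc_ge0 ?success_prob_le1.
move=> i lti; apply: successor_low_digits => //.
by rewrite /j0 -/s; lia.
Qed.

End Operator.
End Eigenvectors.

(** * Approximate eigenvectors *)

Section Spectrum.
Local Open Scope complex_scope.
Variables (R : realType) (p : nat -> R).
Hypothesis hp : forall i, (1 <= i)%N -> 0 < p i <= 1.
Variables (d : measure_display) (Omega : measurableType d) (P : probability Omega R).
Variable e : nat -> {RV P >-> bool}.
Hypothesis he : forall i, P [set w | e i w] = (p i.+1)%:E.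
Hypothesis hind : mutually_independent e.
Local Notation S := (operator (transition_matrix e)).
Local Notation nc := (@Normc.normc R).

Lemma operator_local (v w : nat -> R[i]) N :
  (forall k, (k <= N.+1)%N -> v k = w k) -> S v N = S w N.
Proof.
move=> vw; rewrite !(operatorE he hind) vw //; congr (_ + _).
apply: eq_bigr => j _; rewrite vw //.
by apply: leqW; apply: successor_le; rewrite -ltnS.
Qed.

Lemma operatorZ a (v : nat -> R[i]) N : S (fun i => a * v i) N = a * S v N.
Proof.
rewrite !(operator_sum he hind) mulr_sumr; apply: eq_bigr => j _.
exact: mulrCA.
Qed.

Lemma operatorB (v w : nat -> R[i]) N : S (fun i => v i - w i) N = S v N - S w N.
Proof.
rewrite !(operator_sum he hind) -sumrB; apply: eq_bigr => j _.
exact: mulrBr.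
Qed.

Lemma operator_lincomb n (a : nat -> R[i]) (v : nat -> nat -> R[i]) N :
  S (fun i => \sum_(k < n) a k * v k i) N = \sum_(k < n) a k * S (v k) N.
Proof.
rewrite (operator_sum he hind).
under eq_bigr => j _ do rewrite mulr_sumr.
rewrite exchange_big; apply: eq_bigr => k _ /=.
rewrite (operator_sum he hind) mulr_sumr; apply: eq_bigr => j _.
exact: mulrCA.
Qed.

(** Large vectors with uniformly bounded error become, once normalized, unit vectors
with error O(1/k). *)
Lemma approximate_eigenvalue lambda (C : R) :
  (forall k : nat, exists v : nat -> R[i], [/\ linf v,
     exists i, k.+1%:R <= nc (v i) &
     forall N, nc (lambda * v N - S v N) <= C]) ->
  approximate_point_spectrum (transition_matrix e) lambda.
Proof.
move=> /choice[v hv].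
have : forall k, exists x : nat -> R[i],
    linf_norm x = 1%E /\ forall N, nc (lambda * x N - S x N) <= C / k.+1%:R.
  move=> k; have [vfin [i0 vi0] verr] := hv k.
  have k0 : 0 < k.+1%:R :> R by rewrite ltr0n.
  have [|a [a0 va a1]] := linf_norm_normalized vfin.
    exists i0; apply/eqP => v0; move: vi0; rewrite v0 Normc.normc0.
    by move/(lt_le_trans k0); rewrite ltxx.
  exists (fun i => (a^-1)%:C * v k i); split=> // N.
  rewrite operatorZ mulrCA -mulrBr nc_realM ?invr_ge0 ?(ltW a0) //.
  rewrite mulrC; apply: ler_pM; rewrite ?nc_ge0 ?invr_ge0 ?(ltW a0) //.
  by rewrite lef_pV2 ?posrE // (le_trans vi0).
move=> /choice[x hx]; exists x; split=> [n|n|]; last 1 first.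
- apply: (@squeeze_cvge _ _ _ _ (cst 0%E) _ (fun n => (C / n.+1%:R)%:E)).
  + apply: nearW => n; rewrite linf_norm_ge0 /=.
    by apply/linf_norm_le => N; have [_] := hx n.
  + exact: cvg_cst.
  + apply: cvg_EFin; first by apply: nearW.
    rewrite -(mulr0 C); apply: cvgM; first exact: cvg_cst.
    exact: cvg_harmonic.
- by rewrite /linf /= (hx n).1 ltry.
- by have [] := hx n.
Qed.

(** * Spectral consequences *)

Section BoundedOrbit.
Variable lambda : R[i].
Local Notation q := (digit_weight (fun i => qF p i lambda)).
Local Notation y := (fun n => digit_weight (truncated p lambda n)).

Lemma q_eigenvector N : lambda * q N - S q N = 0.
Proof. exact: formal_eigenvector. Qed.

(** Row N expresses the value at N + 1 by values at earlier states, with the nonzero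
coefficient p_1 ... p_(K+1). *)
Lemma formal_kernel (u : nat -> R[i]) :
  (forall N, S u N - lambda * u N = 0) -> forall N, u N = u 0%N * q N.
Proof.
move=> hu N; have [n] := ubnP N; elim: n N => // n IH [|N] ltN.
  by rewrite digit_weight0 mulr1.
have below m : (m <= N)%N -> u m = u 0%N * q m by move=> leN; apply: IH; lia.
have /eqP := hu N; have /eqP := q_eigenvector N; rewrite !subr_eq0 => /eqP hq /eqP.
have -> : lambda * u N = u 0%N * S q N by rewrite below // -hq mulrCA.
rewrite !(operatorE he hind) mulrDr mulr_sumr.
rewrite (eq_bigr (fun j : 'I_(chain_length N).+1 =>
  u 0%N * ((success_prob p j - success_prob p j.+1)%:C * q (successor N j)))); last first.
  move=> j _; rewrite below; first exact: mulrCA.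
  by apply: successor_le; rewrite -ltnS.
move/addrI; rewrite mulrCA; apply: mulfI.
by rewrite (inj_eq (@complexI R) _ 0) gt_eqF // success_prob_gt0.
Qed.

Variable M : R.
Hypothesis M1 : 1 <= M.
Hypothesis qM : forall i, nc (qF p i lambda) <= M.
Let C := M * M + M + 1.

Lemma C_ge0 : 0 <= C. Proof. by rewrite /C; nra. Qed.

Lemma unbounded_approximate : (forall B, exists N, B <= nc (q N)) ->
  approximate_point_spectrum (transition_matrix e) lambda.
Proof.
move=> qunb; apply: (@approximate_eigenvalue _ C) => k.
have [N leN] := qunb k.+1%:R; exists (y N.+1); split.
- by apply/linfP; exists (M ^+ N.+1) => i; exact: digit_weight_truncated_bound.
- exists N; rewrite digit_weight_truncated_small //.
  by rewrite (leq_trans (fib_gt N)) // fib_mono.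
- by move=> i; exact: truncated_eigen_bound.
Qed.

Lemma bounded_approximate (B : R) : (forall N, nc (q N) <= B) ->
  approximate_point_spectrum (transition_matrix e) lambda.
Proof.
move=> qB; apply: (@approximate_eigenvalue _ 0) => k.
have nat_nc : nc (k.+1%:R : R[i]) = k.+1%:R.
  by rewrite -(rmorph_nat (@real_complex R)) nc_real ger0_norm.
exists (fun N => k.+1%:R * q N); split.
- apply/linfP; exists (k.+1%:R * B) => N.
  by rewrite Normc.normcM nat_nc ler_wpM2l.
- by exists 0%N; rewrite digit_weight0 mulr1 nat_nc.
- by move=> N; rewrite operatorZ mulrCA -mulrBr q_eigenvector mulr0 Normc.normc0.
Qed.

Lemma bounded_spectrum (B : R) : (forall N, nc (q N) <= B) ->
  spectrum (transition_matrix e) lambda.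
Proof.
move=> qB [_ inj _].
have S0 N : S (fun=> 0) N = 0.
  by have := operatorZ 0 (fun=> 0) N; rewrite !mul0r.
have : q = fun=> 0.
  apply: inj.
  - by rewrite inE; apply/linfP; exists B.
  - by rewrite inE; apply/linfP; exists 0 => N; rewrite Normc.normc0.
  - apply/funext => N; rewrite S0 mulr0 subr0.
    by apply/eqP; rewrite -oppr_eq0 opprB q_eigenvector.
by move/(congr1 (fun f => f 0%N)); rewrite digit_weight0 => /eqP; rewrite oner_eq0.
Qed.

(** * A gliding hump *)

Section GlidingHump.
Hypothesis qunb : forall B, exists N, B <= nc (q N).

(** The term (2k+1) M^m is what the first k terms of the hump and the subtracted
truncation can contribute; 2^(k+2) undoes the coefficient 2^-k and leaves a factor
4 that absorbs the choice of a site in [hump_unbounded]. *)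
Lemma next_scale (k m : nat) : exists m' N, [/\ (m < m')%N, (N < fib m')%N &
  2 ^+ k.+2 * (k.*2.+1%:R * M ^+ m + k%:R) <= nc (q N)].
Proof.
have [N hN] := qunb (2 ^+ k.+2 * (k.*2.+1%:R * M ^+ m + k%:R)).
exists (maxn m N).+1, N; split=> //; first by rewrite ltnS leq_maxl.
by apply: leq_trans (fib_gt N) (fib_mono _); rewrite leqW // leq_maxr.
Qed.

Variables (m : nat -> nat) (site : nat -> nat).
Hypothesis m0 : m 0%N = 1%N.
Hypothesis m_incr : forall k, (m k < m k.+1)%N.
Hypothesis site_lt : forall k, (site k < fib (m k.+1))%N.
Hypothesis site_large : forall k,
  2 ^+ k.+2 * (k.*2.+1%:R * M ^+ m k + k%:R) <= nc (q (site k)).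

Let coef (k : nat) : R := 2^-1 ^+ k.
Definition hump_term (k N : nat) : R[i] := y (m k.+1) N - y (m k) N.
(** The k-th term vanishes on [0, F_(m_k)[, which contains [0, k], so cutting the sum
at N loses nothing. *)
Definition hump (N : nat) : R[i] := \sum_(k < N) (coef k)%:C * hump_term k N.

Lemma coef_ge0 k : 0 <= coef k.
Proof. by rewrite exprn_ge0 // invr_ge0. Qed.

Lemma coef_le1 k : coef k <= 1.
Proof. by rewrite exprn_ile1 // ?invr_ge0 // invf_le1 // ler1n. Qed.

Lemma sum_coef n : \sum_(k < n) coef k <= 2.
Proof.
suff -> : \sum_(k < n) coef k = 2 - 2 * coef n by rewrite gerBl mulr_ge0 // coef_ge0.
elim: n => [|n IH]; first by rewrite big_ord0 /coef expr0 mulr1 subrr.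
by rewrite big_ord_recr /= IH /coef exprS; field.
Qed.

Lemma m_mono i j : (i <= j)%N -> (m i <= m j)%N.
Proof.
elim: j => [|j IH]; first by rewrite leqn0 => /eqP->.
by rewrite leq_eqVlt => /orP[/eqP->//|/IH h]; apply: leq_trans h (ltnW _).
Qed.

Lemma m_gt k : (k < m k)%N.
Proof. by elim: k => [|k IH]; [rewrite m0|apply: leq_trans (m_incr k)]. Qed.

Lemma hump_term_small k N : (N < fib (m k))%N -> hump_term k N = 0.
Proof.
move=> ltN; rewrite /hump_term !digit_weight_truncated_small ?subrr //.
by apply: leq_trans ltN _; apply: fib_mono; exact: m_mono.
Qed.

Lemma humpE n N : (N < fib (m n))%N ->
  hump N = \sum_(k < n) (coef k)%:C * hump_term k N.
Proof.
have widen i j : (N < fib (m i))%N -> (i <= j)%N ->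
    \sum_(k < j) (coef k)%:C * hump_term k N = \sum_(k < i) (coef k)%:C * hump_term k N.
  move=> ltN leij; rewrite -!(big_mkord xpredT (fun k => (coef k)%:C * hump_term k N)).
  rewrite (big_cat_nat _ leij) //= [X in _ + X]big_nat_cond [X in _ + X]big1 ?addr0 // => k.
  rewrite andbT => /andP[leik _]; rewrite hump_term_small ?mulr0 //.
  by apply: leq_trans ltN (fib_mono (m_mono leik)).
move=> ltN; rewrite /hump; have ltNN : (N < fib (m N))%N.
  by apply: leq_trans (fib_gt N) (fib_mono (ltnW (m_gt N))).
by case: (leqP n N) => [|/ltnW] h; [exact: widen|rewrite (widen N n)].
Qed.

Lemma hump_image N : S hump N - lambda * hump N =
  \sum_(k < N.+1) (coef k)%:C * (S (hump_term k) N - lambda * hump_term k N).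
Proof.
have ltm i : (i <= N.+1)%N -> (i < fib (m N.+1))%N.
  move=> lei; apply: leq_ltn_trans lei _.
  by apply: leq_trans (fib_gt _) (fib_mono (ltnW (m_gt _))).
rewrite (@operator_local _ (fun i => \sum_(k < N.+1) (coef k)%:C * hump_term k i)); last first.
  by move=> i /ltm; exact: humpE.
rewrite (@operator_lincomb N.+1 (fun k => (coef k)%:C) hump_term).
rewrite (humpE (ltm _ (leqnSn N))) mulr_sumr -sumrB.
by apply: eq_bigr => k _; ring.
Qed.

Lemma hump_term_image k N : nc (S (hump_term k) N - lambda * hump_term k N) <= C + C.
Proof.
rewrite operatorB mulrBr opprB.
have -> : S (y (m k.+1)) N - S (y (m k)) N + (lambda * y (m k) N - lambda * y (m k.+1) N)
  = (lambda * y (m k) N - S (y (m k)) N) - (lambda * y (m k.+1) N - S (y (m k.+1)) N).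
  by ring.
by apply: (le_trans (ncB _ _)); apply: lerD; apply: truncated_eigen_bound => //;
  exact: leq_trans (m_gt _).
Qed.

Lemma hump_image_bounded N : nc (S hump N - lambda * hump N) <= 2 * (C + C).
Proof.
rewrite hump_image; apply: (le_trans (nc_sum _ _ _)).
apply: (@le_trans _ _ (\sum_(k < N.+1) coef k * (C + C))).
  apply: ler_sum => k _; rewrite nc_realM ?coef_ge0 //.
  by rewrite ler_wpM2l ?coef_ge0 ?hump_term_image.
by rewrite -mulr_suml ler_wpM2r ?sum_coef // addr_ge0 ?C_ge0.
Qed.

(** At the k-th site the later terms vanish and y_(m_(k+1)) equals q, so hump + c q is
(2^-k + c) q up to an error controlled by the earlier scales. *)
Lemma hump_site c k :
  nc ((coef k)%:C + c) * nc (q (site k)) <=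
  nc (hump (site k) + c * q (site k)) + k.*2.+1%:R * M ^+ m k.
Proof.
have M0 : 0 <= M := le_trans ler01 M1.
rewrite (humpE (site_lt k)) big_ord_recr /= {2}/hump_term.
rewrite (digit_weight_truncated_small _ _ (site_lt k)).
set Z := \sum_(j < k) _; set N := site k.
have Zle : nc Z <= k.*2%:R * M ^+ m k.
  apply: (le_trans (nc_sum _ _ _)).
  apply: (@le_trans _ _ (\sum_(j < k) (M ^+ m k + M ^+ m k))).
    apply: ler_sum => j _; rewrite nc_realM ?coef_ge0 //.
    apply: (@le_trans _ _ (nc (hump_term j N))); first by rewrite ler_piMl ?nc_ge0 ?coef_le1.
    apply: (le_trans (ncB _ _)); apply: lerD.
      apply: (le_trans (digit_weight_truncated_bound M1 qM _ _)).
      by apply: ler_weXn2l => //; apply: m_mono; exact: ltn_ord.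
    apply: (le_trans (digit_weight_truncated_bound M1 qM _ _)).
    by apply: ler_weXn2l => //; apply: m_mono; exact: ltnW.
  by rewrite sumr_const card_ord -mulr2n -mulrnA mulr_natl mul2n.
have yle : nc ((coef k)%:C * y (m k) N) <= M ^+ m k.
  rewrite nc_realM ?coef_ge0 //.
  apply: le_trans (digit_weight_truncated_bound M1 qM (m k) N).
  by rewrite ler_piMl ?nc_ge0 ?coef_le1.
rewrite -Normc.normcM.
have -> : ((coef k)%:C + c) * q N =
    Z + (coef k)%:C * (q N - y (m k) N) + c * q N - (Z - (coef k)%:C * y (m k) N) by ring.
apply: (le_trans (ncB _ _)); rewrite lerD2l; apply: (le_trans (ncB _ _)).
by rewrite -natr1 mulrDl mul1r; exact: lerD.
Qed.

Lemma hump_unbounded c B : ~ forall N, nc (hump N + c * q N) <= B.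
Proof.
move=> hB; pose k0 := (Num.truncn `|B|).+1.
have k0B : B < k0%:R by apply: le_lt_trans (ler_norm B) _; exact: truncnS_gt.
have [k lek hk] : exists2 k, (k0 <= k)%N & coef k <= 2 ^+ 2 * nc ((coef k)%:C + c).
  (* 2^-k + c can nearly vanish for at most one of two consecutive k. *)
  case: (leP (coef k0) (2 ^+ 2 * nc ((coef k0)%:C + c))) => h0; first by exists k0.
  case: (leP (coef k0.+1) (2 ^+ 2 * nc ((coef k0.+1)%:C + c))) => h1; first by exists k0.+1.
  have := ncB ((coef k0)%:C + c) ((coef k0.+1)%:C + c).
  rewrite opprD addrACA subrr addr0 -rmorphB nc_real.
  have coefS : coef k0.+1 = 2^-1 * coef k0 by rewrite /coef exprS.
  have := coef_ge0 k0; move: h0 h1; rewrite coefS.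
  rewrite ger0_norm; last by have := coef_ge0 k0; lra.
  lra.
have coef2 : coef k * 2 ^+ k = 1 by rewrite /coef -exprMn mulVf ?expr1n.
have := site_large k; set L := k.*2.+1%:R * M ^+ m k + k%:R => hL.
have L0 : 0 <= L by rewrite addr_ge0 // mulr_ge0 // exprn_ge0 // (le_trans ler01 M1).
have := hump_site c k; have := hB (site k).
have : L <= nc ((coef k)%:C + c) * nc (q (site k)).
  apply: le_trans (ler_wpM2l (nc_ge0 _) hL).
  have := ler_wpM2r (mulr_ge0 (exprn_ge0 k (ler0n R 2)) L0) hk.
  rewrite mulrA coef2 mul1r => h; apply: (le_trans h).
  by rewrite le_eqVlt; apply/orP; left; apply/eqP; rewrite !exprS; ring.
have : k0%:R <= k%:R :> R by rewrite ler_nat.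
rewrite /L; lra.
Qed.

(** A bounded preimage of the image of the hump would be hump + c q for some c. *)
Lemma hump_spectrum : spectrum (transition_matrix e) lambda.
Proof.
move=> [_ _ surj].
have : linf (fun N => S hump N - lambda * hump N).
  by apply/linfP; exists (2 * (C + C)); exact: hump_image_bounded.
move=> /surj[x /linfP[B xB] xE].
pose u N := x N - hump N.
have uE : forall N, u N = u 0%N * q N.
  apply: formal_kernel => N; rewrite /u operatorB.
  have xN : S x N - lambda * x N = S hump N - lambda * hump N.
    exact: (congr1 (fun f => f N) xE).
  have <- : S x N - lambda * x N - (S hump N - lambda * hump N) = 0.
    by rewrite xN subrr.
  ring.
apply: (@hump_unbounded (u 0%N) B) => N.
by rewrite -uE /u addrC subrK.
Qed.

End GlidingHump.

Lemma unbounded_spectrum : (forall B, exists N, B <= nc (q N)) ->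
  spectrum (transition_matrix e) lambda.
Proof.
move=> qunb.
have : forall km : nat * nat, exists mN : nat * nat,
    [/\ (km.2 < mN.1)%N, (mN.2 < fib mN.1)%N &
    2 ^+ km.1.+2 * (km.1.*2.+1%:R * M ^+ km.2 + km.1%:R) <= nc (q mN.2)].
  by move=> [k i]; have [m [N h]] := next_scale qunb k i; exists (m, N).
move=> /choice[f hf].
pose m := fix m k := if k is j.+1 then (f (j, m j)).1 else 1%N.
apply: (@hump_spectrum m (fun k => (f (k, m k)).2)) => // k;
  by have [] := hf (k, m k).
Qed.

End BoundedOrbit.

End Spectrum.

Theorem theorem3p8 (R : realType) (p : nat -> R)
  (hp : forall i, (1 <= i)%N -> 0 < p i <= 1)
  (d : measure_display) (Omega : measurableType d) (P : probability Omega R)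
  (e : nat -> {RV P >-> bool})
  (he : forall i, P [set w | e i w] = (p i.+1)%:E)
  (hind : mutually_independent e) :
  bounded_orbit_set p `<=` approximate_point_spectrum (transition_matrix e) /\
  bounded_orbit_set p `<=` spectrum (transition_matrix e).
Proof.
have bound lambda : bounded_orbit_set p lambda ->
    exists2 M : R, 1 <= M & forall i, Normc.normc (qF p i lambda) <= M.
  move=> [M qM]; exists (Num.max M 1); first by rewrite le_max lexx orbT.
  by move=> i; rewrite le_max qM.
pose q lambda := digit_weight (fun i => qF p i lambda).
have unbounded lambda : ~ (exists B, forall N, Normc.normc (q lambda N) <= B) ->
    forall B, exists N, B <= Normc.normc (q lambda N).
  move=> nB B; apply: contrapT => nN; apply: nB; exists B => N.
  by rewrite leNgt; apply/negP => /ltW h; apply: nN; exists N.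
split=> lambda /bound[M M1 qM].
  have [[B qB]|/unbounded nB] := pselect (exists B, forall N, Normc.normc (q lambda N) <= B).
    exact: (bounded_approximate hp he hind qB).
  exact: (unbounded_approximate hp he hind M1 qM nB).
have [[B qB]|/unbounded nB] := pselect (exists B, forall N, Normc.normc (q lambda N) <= B).
  exact: (bounded_spectrum hp he hind qB).
exact: (unbounded_spectrum hp he hind M1 qM nB).
Qed.
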